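(* There is an absolute constant $C>0$ such that for all integers $w\ge 2$ and $t\ge 2$ there exists a worker-task assignment function for $w$ workers and $t$ tasks whose switching cost is at most $C\log w\,\log(wt)$.
   Context: Let $w,t$ be positive integers. A task multiset is a multiset $T$ of size $|T|=w$ whose elements lie in $[t]=\{1,\dots,t\}$ (multiplicities may be arbitrary); write $m_T(j)$ for the multiplicity of $j$ in $T$. A worker-task assignment function $\phi$ assigns to every task multiset $T$ an assignment of the workers $[w]=\{1,\dots,w\}$ to tasks, i.e. a map $\phi(T):[w]\to[t]$ such that for each task $j$ exactly $m_T(j)$ workers are mapped to $j$. (It depends only on $T$.) Two task multisets $T_1,T_2$ of size $w$ are adjacent if $|T_1\setminus T_2|=|T_2\setminus T_1|=1$ (multiset difference: $m_{A\setminus B}(i)=\max(0,m_A(i)-m_B(i))$). The switching cost between adjacent $T_1,T_2$ is the number of workers $i\in[w]$ with $\phi(T_1)(i)\ne\phi(T_2)(i)$; the switching cost of $\phi$ is the maximum of this quantity over all pairs of adjacent task multisets. *)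

(* Defs.v *)
From HB Require Import structures.
From mathcomp Require Import all_boot finmap multiset.

Set Implicit Arguments.
Unset Strict Implicit.
Unset Printing Implicit Defensive.

Local Open Scope mset_scope.

(* Workers and tasks are numbered from 0: 'I_w and 'I_t stand for [w] and [t].
   For T : {mset 'I_t}, T j is the multiplicity of j, and size T counts elements
   with multiplicity (whereas #|T| counts distinct ones). *)
Record task_multiset (w t : nat) := TaskMultiset {
  tasks : {mset 'I_t};
  _ : size tasks == w
}.

HB.instance Definition _ (w t : nat) := [isSub for @tasks w t].
HB.instance Definition _ (w t : nat) := [Choice of task_multiset w t by <:].

(* There are finitely many task multisets, as each is determined by a w-tuple
   listing its elements; this makes the maximum in switching_cost well defined. *)
Section TaskMultisetFinite.
Variables w t : nat.

Definition tuple_of_task_multiset (T : task_multiset w t) : w.-tuple 'I_t :=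
  Tuple (valP T).

Definition task_multiset_of_tuple (s : w.-tuple 'I_t) :
  option (task_multiset w t) := insub (seq_mset s).

Lemma tuple_of_task_multisetK :
  pcancel tuple_of_task_multiset task_multiset_of_tuple.
Proof. by move=> T; rewrite /task_multiset_of_tuple /= seq_mset_id valK. Qed.

HB.instance Definition _ := PCanIsCountable tuple_of_task_multisetK.
HB.instance Definition _ : isFinite (task_multiset w t) :=
  PCanIsFinite tuple_of_task_multisetK.

End TaskMultisetFinite.

Definition is_assignment_function (w t : nat)
    (phi : task_multiset w t -> 'I_w -> 'I_t) : Prop :=
  forall (T : task_multiset w t) (j : 'I_t),
    #|[set i : 'I_w | phi T i == j]| = tasks T j.

Definition adjacent (w t : nat) (T1 T2 : task_multiset w t) : bool :=
  (size (tasks T1 `\` tasks T2) == 1) && (size (tasks T2 `\` tasks T1) == 1).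

Definition pair_switching_cost (w t : nat)
    (phi : task_multiset w t -> 'I_w -> 'I_t) (T1 T2 : task_multiset w t) : nat :=
  #|[set i : 'I_w | phi T1 i != phi T2 i]|.

Definition switching_cost (w t : nat)
    (phi : task_multiset w t -> 'I_w -> 'I_t) : nat :=
  \max_(p : task_multiset w t * task_multiset w t | adjacent p.1 p.2)
    pair_switching_cost phi p.1 p.2.

(* Main.v *)
(* Give the copies of each task distinct names, so that a task multiset becomes
   a set of w elements of [t] x [w].  Fix a sequence of rounds, each hashing
   workers and tasks to bins; in every bin containing a remaining worker and a
   remaining task, the smallest such worker takes the smallest such task.  If
   two inputs of a round differ by one element, so do the remainders, and only
   O(1) partners change; hence the switching cost is O(number of rounds).

   It remains to clear everything in O(log w log(wt)) rounds.  For sets A of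
   workers and D of tasks, both of size r, a random hash to r bins has at most
   r/7 bins meeting both A and D with probability at most (48/49)^r.  As there
   are at most |E|^(2r) pairs (A, D), where E is the set of all workers and task
   copies, some O(log |E|) hashes leave no pair bad for all of them.  If r
   workers (hence r tasks) out of at most 8r/7 survived these rounds, some round
   would have matched more than r/7 workers, a contradiction.  So O(log |E|)
   rounds shrink the number of workers by a factor 7/8. *)

Require Import Defs.
From mathcomp Require Import all_boot all_order all_algebra.
From mathcomp Require Import reals exp.
From mathcomp Require Import finmap multiset zify.

Import Order.TTheory GRing.Theory Num.Theory.
Set Implicit Arguments.
Unset Strict Implicit.
Unset Printing Implicit Defensive.
Local Open Scope nat_scope.

(** * Elementary counting bounds *)

Lemma leq_bin_exp n m : 'C(n, m) <= n ^ m.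
Proof.
have ffact_leq : n ^_ m <= n ^ m.
  elim: m => [|m IHm]; first by rewrite ffactn0 expn0.
  by rewrite ffactnSr expnSr leq_mul ?leq_subr.
by apply: leq_trans ffact_leq; rewrite -bin_ffact leq_pmulr // fact_gt0.
Qed.

(** Union bound cleared of denominators: a bound on a probability is kept as an inequality between
    two products in [nat]. *)
Lemma card_cover_leq (T I : finType) (B : {set T}) (P : pred I)
    (S : I -> {set T}) k n :
  (forall x, x \in B -> exists2 i, P i & x \in S i) ->
  (forall i, P i -> k * #|S i| <= n) -> k * #|B| <= #|P| * n.
Proof.
move=> cover cardS; rewrite -sum_nat_const.
apply: (@leq_trans (k * #|\bigcup_(i | P i) S i|)).
  rewrite leq_mul2l; apply/orP; right; apply/subset_leq_card/subsetP => x.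
  by case/cover=> i Pi Six; apply/bigcupP; exists i.
apply: (@leq_trans (\sum_(i | P i) k * #|S i|)); last exact: leq_sum.
rewrite -big_distrr leq_mul2l /=; apply/orP; right.
elim/big_rec2: _ => [|i n' U _ IH]; first by rewrite cards0.
by rewrite (leq_trans (leq_card_setU _ _)) ?leq_add2l.
Qed.

Lemma leq_wexp2r m n e : m <= n -> m ^ e <= n ^ e.
Proof. by case: e => [//|e]; rewrite leq_exp2r. Qed.

(** * Random hashes *)

Section Hashing.
Variable E : finType.
Implicit Types (A D : {set E}).

(** The hash values are chosen independently: [#|c1|] choices at each point of [A], [#|c2|] at each
    point of [D], and [r] elsewhere. *)
Lemma card_hash_labelled r (c1 c2 : {set 'I_r}) A D :
  #|A| = r -> #|D| = r -> [disjoint A & D] ->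
  #|[set c : {ffun E -> 'I_r} | (c @: A \subset c1) && (c @: D \subset c2)]|
  = (#|c1| * #|c2|) ^ r * r ^ (#|E| - r.*2).
Proof.
move=> cardA cardD disjAD.
pose F (e : E) := mem (if e \in A then c1 else if e \in D then c2 else setT).
have nD e : e \in D -> (e \in A) = false.
  by move=> De; apply: contraTF De => Ae; rewrite (disjointFr disjAD).
transitivity #|family F|.
  apply: eq_card => c; rewrite !inE; apply/andP/familyP.
    move=> [/subsetP cA /subsetP cD] e; rewrite /F.
    case: ifP => Ae; first by apply: cA; apply: imset_f.
    by case: ifP => De; [apply: cD; apply: imset_f | rewrite inE].
  move=> Fc; split; apply/subsetP => _ /imsetP[e eX ->]; have := Fc e.
    by rewrite /F eX.
  by rewrite /F eX nD.
rewrite card_family foldrE big_map big_enum /=.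
rewrite (bigID (fun e => e \in A)) /=.
rewrite (bigID (fun e => e \in D) (fun e => e \notin A)) /=.
rewrite (eq_bigr (fun=> #|c1|)); last by move=> e Ae; rewrite /F Ae.
rewrite (eq_bigl (fun e => e \in D) (fun e => #|F e|)); last first.
  by move=> e /=; case De: (e \in D); rewrite ?andbT ?andbF // nD.
rewrite (eq_bigr (fun=> #|c2|) (P := fun e => e \in D)); last first.
  by move=> e De; rewrite /F De nD.
rewrite (eq_bigr (fun=> r) (P := fun e => (e \notin A) && (e \notin D)));
  last first.
  by move=> e /andP[/negbTE-> /negbTE->]; rewrite cardsT card_ord.
rewrite [X in _ * (_ * X)](eq_bigl (fun e => e \in ~: (A :|: D))); last first.
  by move=> e; rewrite !inE negb_or.
rewrite !prod_nat_const cardA cardD expnMn -mulnA; congr (_ * (_ * r ^ _)).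
rewrite cardsCs setCK cardsU disjoint_setI0 // cards0 cardA cardD.
by rewrite subn0 addnn.
Qed.

(* Label the bins met by A and D with None, the other bins met by A with
   Some true, and the rest with Some false.  Given the labelling, A is hashed
   into p bins and D into q bins, where p + q <= 8r/7 and hence
   pq <= (16/49) r^2.  There are 3^r labellings, and 3 * 16 = 48. *)
Lemma card_hash_miss r A D :
  #|A| = r -> #|D| = r -> [disjoint A & D] ->
  49 ^ r * #|[set c : {ffun E -> 'I_r} | 7 * #|c @: A :&: c @: D| <= r]|
  <= 48 ^ r * r ^ #|E|.
Proof.
move=> cardA cardD disjAD.
have leE : r.*2 <= #|E|.
  rewrite -addnn -{1}cardA -cardD -(cardsUI A D) disjoint_setI0 //.
  by rewrite cards0 addn0 max_card.
pose P (f : {ffun 'I_r -> option bool}) := 7 * #|f @^-1: [set None]| <= r.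
pose S1 (f : {ffun 'I_r -> option bool}) := f @^-1: [set~ Some false].
pose S2 (f : {ffun 'I_r -> option bool}) := f @^-1: [set~ Some true].
set B := [set c | _].
pose n := (16 * r ^ 2) ^ r * r ^ (#|E| - r.*2).
pose H f := [set c : {ffun E -> 'I_r} |
              (c @: A \subset S1 f) && (c @: D \subset S2 f)].
have cover c : c \in B -> exists2 f, P f & c \in H f.
  rewrite inE => cB.
  exists [ffun b => if b \in c @: A then
                      if b \in c @: D then None else Some true else Some false].
    rewrite /P; apply: leq_trans cB; rewrite leq_mul2l /=.
    apply/subset_leq_card/subsetP=> b; rewrite !inE ffunE.
    by case: (b \in c @: A) (b \in c @: D) => [] [].
  rewrite inE; apply/andP; split; apply/subsetP=> b bX; rewrite !inE ffunE bX.
    by case: (_ \in _).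
  by case: (_ \in _).
have cardS f : P f -> 49 ^ r * #|H f| <= n.
  move=> Pf; rewrite card_hash_labelled // mulnA -expnMn leq_mul2r.
  apply/orP; right; apply: leq_wexp2r.
  (* A bin labelled [None] lies in both preimages, any other bin in exactly one. *)
  have sumS : #|S1 f| + #|S2 f| = r + #|f @^-1: [set None]|.
    rewrite -cardsUI; congr (_ + _); last first.
      by apply: eq_card => b; rewrite !inE; case: (f b) => [[]|].
    rewrite -[RHS]card_ord -cardsT; apply: eq_card => b.
    by rewrite !inE; case: (f b) => [[]|].
  move: Pf sumS; rewrite /P; move: #|S1 f| #|S2 f| #|_ @^-1: _| => p q b.
  move=> ler sumpq.
  have ler' : 7 * (p + q) <= 8 * r by lia.
  have [AGM _] := nat_AGM2 p q.
  rewrite -(leq_pmul2l (_ : 0 < 4)) //.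
  by have := leq_mul ler' ler'; rewrite -!mulnn; move: AGM; rewrite -mulnn; nia.
apply: leq_trans (card_cover_leq cover cardS) _.
apply: (@leq_trans (3 ^ r * n)).
  rewrite leq_mul2r (leq_trans (max_card _)) ?orbT //.
  by rewrite card_ffun card_option card_bool card_ord.
rewrite /n expnMn -mulnA -expnM mul2n -expnD subnKC //.
by rewrite mulnA -expnMn.
Qed.

(** Probabilistic method: a fixed pair is missed by all [L] independent hashes with probability at
    most (48/49)^(rL), and there are at most |E|^(2r) pairs. The union bound leaves a good family if
    the product is below 1; taking r-th roots gives a condition on [L] free of [r]. *)
Lemma hash_family_exists r L :
  0 < r -> #|E| ^ 2 * 48 ^ L < 49 ^ L ->
  exists cs : {ffun 'I_L -> {ffun E -> 'I_r}}, forall A D,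
    #|A| = r -> #|D| = r -> [disjoint A & D] ->
    exists i, r < 7 * #|cs i @: A :&: cs i @: D|.
Proof.
move=> r_gt0 ltL.
pose miss (p : {set E} * {set E}) :=
  [set c : {ffun E -> 'I_r} | 7 * #|c @: p.1 :&: c @: p.2| <= r].
pose P (p : {set E} * {set E}) :=
  [&& #|p.1| == r, #|p.2| == r & [disjoint p.1 & p.2]].
pose family := {ffun 'I_L -> {ffun E -> 'I_r}}.
pose bad (p : {set E} * {set E}) :=
  [set cs : family | [forall i, cs i \in miss p]].
pose good (cs : family) := [forall p, P p ==> (cs \notin bad p)].
case: (pickP good) => [cs /forallP csP | nogood].
  exists cs => A D cardA cardD disjAD; have := csP (A, D).
  rewrite /P /= cardA cardD disjAD eqxx inE negb_forall => /existsP[i].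
  by rewrite inE -ltnNge => lt_r; exists i.
have cover cs : cs \in [set: family] -> exists2 p, P p & cs \in bad p.
  move=> _; have /negbT := nogood cs; rewrite negb_forall => /existsP[p].
  by rewrite negb_imply negbK => /andP[Pp csp]; exists p.
have cardbad p : P p -> (49 ^ r) ^ L * #|bad p| <= (48 ^ r * r ^ #|E|) ^ L.
  case/and3P=> /eqP card1 /eqP card2 disj12.
  rewrite (_ : #|bad p| = #|miss p| ^ L); last first.
    rewrite -[in RHS](card_ord L) -card_ffun_on; apply: eq_card => cs.
    by rewrite inE; apply/forallP/ffun_onP.
  rewrite -expnMn; apply: leq_wexp2r; exact: card_hash_miss.
have cardP : #|P| <= (#|E| ^ r) ^ 2.
  apply: (@leq_trans ('C(#|E|, r) ^ 2)); last by rewrite leq_sqr leq_bin_exp.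
  rewrite -mulnn -card_draws -cardsX.
  by apply/subset_leq_card/subsetP => p; rewrite !inE => /and3P[-> -> _].
have := card_cover_leq cover cardbad.
rewrite cardsT !card_ffun !card_ord leqNgt => /negP[].
rewrite expnMn mulnA ltn_pmul2r; last by rewrite !expn_gt0 r_gt0.
apply: (@leq_ltn_trans ((#|E| ^ 2 * 48 ^ L) ^ r)); last first.
  by rewrite -expnM (mulnC r) expnM ltn_exp2r.
rewrite expnMn leq_mul //; last by rewrite -!expnM mulnC.
by rewrite -expnM mulnC expnM.
Qed.

End Hashing.

(** * Matching rounds *)

Section Rounds.
Variables (E : finType) (side : E -> bool).
Implicit Types (S : {set E}) (c : E -> nat) (e : E) (k : bool * nat).

(** Bins are natural numbers, so that hashes with different numbers of bins can occur in one
    sequence of rounds. *)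
Definition class c e := (side e, c e).
Definition opp_class k := (~~ k.1, k.2).

Definition top c S k : option E :=
  [pick e in S | (class c e == k) &&
     [forall e' in S, (class c e' == k) ==> (enum_rank e <= enum_rank e')]].

Variant top_spec c S k : option E -> Prop :=
| TopSome e of e \in S & class c e = k &
    (forall e', e' \in S -> class c e' = k -> enum_rank e <= enum_rank e') :
    top_spec c S k (Some e)
| TopNone of (forall e, e \in S -> class c e <> k) : top_spec c S k None.

Lemma topP c S k : top_spec c S k (top c S k).
Proof.
rewrite /top; case: pickP => [e /and3P[Se /eqP ek /forall_inP mine] | none].
  constructor=> // e' Se' e'k; have /implyP-> // := mine e' Se'.
  exact/eqP.
constructor=> e Se ek.
have Pe : (e \in S) && (class c e == k) by rewrite Se ek eqxx.
have := none [arg min_(i < e | (i \in S) && (class c i == k)) enum_rank i].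
case: arg_minnP => // i /andP[Si ik] mini /negP[]; rewrite /= Si ik /=.
by apply/forall_inP=> e' Se'; apply/implyP=> e'k; apply: mini; rewrite Se'.
Qed.

Lemma topE c S e :
  e \in S ->
  (forall e', e' \in S -> class c e' = class c e ->
     enum_rank e <= enum_rank e') ->
  top c S (class c e) = Some e.
Proof.
move=> Se mine; case: topP => [e' Se' e'k mine' | /(_ e Se) //].
congr Some; apply/enum_rank_inj/val_inj/eqP.
by rewrite eqn_leq /= mine' // mine.
Qed.

Definition partner c S e : option E :=
  if top c S (class c e) == Some e then top c S (opp_class (class c e))
  else None.

Definition leftover c S := [set e in S | partner c S e == None].

Lemma opp_classK : involutive opp_class.
Proof. by case=> b i; rewrite /opp_class /= negbK. Qed.

Lemma opp_class_neq k : (opp_class k == k) = false.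
Proof. by case: k => [[] i]; apply/eqP. Qed.

Lemma topS c S k e : top c S k = Some e -> e \in S /\ class c e = k.
Proof. by case: topP => // e' Se' e'k _ [<-]. Qed.

Lemma partnerP c S e e' : partner c S e = Some e' ->
  [/\ e \in S, e' \in S, side e' = ~~ side e & partner c S e' = Some e].
Proof.
rewrite /partner; case: eqP => // te te'.
have [Se _] := topS te; have [Se' ke'] := topS te'.
by rewrite ke' te' eqxx opp_classK te; case: ke' => ->.
Qed.

(** * Stability of one round under a one-element change *)

(** The new element either is not the smallest of its class, and no top moves, or it becomes the top
    of its class, and the other classes keep theirs. *)
Lemma top_setU1 c S a : a \notin S ->
  top c (a |: S) =1 top c S \/
  forall k, top c (a |: S) k = if k == class c a then Some a else top c S k.
Proof.
move=> nSa; case: (eqVneq (top c (a |: S) (class c a)) (Some a)) => ta.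
  right=> k; case: eqP => [->//|nk].
  case: (@topP c S k) => [e Se ek mine | none].
    rewrite -ek; apply: topE; first by rewrite !inE Se orbT.
    move=> e' /setU1P[-> | Se'] ke'; first by case: nk; rewrite -ek.
    by apply: mine; rewrite // ke'.
  case: topP => // e /setU1P[->|Se] ek _; first by case: nk.
  by case: (none e).
left=> k; case: (@topP c (a |: S) k) ta => [e Se ek mine | none] ta.
  have {}Se : e \in S.
    case/setU1P: Se ek mine => // -> ek mine; case/eqP: ta.
    apply: topE; first exact: setU11.
    by move=> e' Se' e'a; apply: mine; rewrite // e'a.
  rewrite -ek; apply/esym/topE => // e' Se' e'k.
  by apply: mine; rewrite ?e'k // !inE Se' orbT.
by case: topP => // e Se ek _; case: (none e) => //; rewrite !inE Se orbT.
Qed.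

Lemma round_setU1 c S a : a \notin S ->
  (exists a', {in [set~ a'], leftover c (a |: S) =i leftover c S}) /\
  #|[set e | partner c (a |: S) e != partner c S e]| <= 3.
Proof.
move=> nSa; case: (top_setU1 c nSa) => Htop.
  have Hp e : partner c (a |: S) e = partner c S e by rewrite /partner !Htop.
  split; last by rewrite eq_card0 // => e; rewrite !inE Hp eqxx.
  by exists a => e; rewrite !inE Hp => /negbTE->.
(* Here [a] becomes the top of its class, displacing [b] if there is one, and faces [o]. Only [a],
   [b] and [o] can change partner, whence the constant 3. *)
pose ka := class c a; pose o := top c S (opp_class ka); pose b := top c S ka.
have Hp e : e != a -> Some e != b -> Some e != o ->
    partner c (a |: S) e = partner c S e.
  move=> nea; rewrite /partner !Htop /b /o -/ka => neb neo.
  case: (eqVneq (class c e) ka) => [->|nk].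
    have nea' : (Some a == Some e) = false.
      by apply/eqP => -[/esym/eqP]; apply/negP.
    by rewrite nea' eq_sym (negbTE neb).
  case: eqP => // te; case: eqP => // kb; case/eqP: neo.
  by rewrite -te -kb opp_classK.
have pa : partner c (a |: S) a = o.
  by rewrite /partner !Htop -/ka eqxx eqxx opp_class_neq.
have pb e : b = Some e -> partner c S e = o /\ partner c (a |: S) e = None.
  move=> be; have [Se ek] := topS be.
  rewrite /partner !Htop ek -/ka eqxx -/b be eqxx; split=> //.
  by case: eqP => // -[eae]; rewrite eae Se in nSa.
have po e : o = Some e -> partner c S e = b /\ partner c (a |: S) e = Some a.
  move=> oe; have [Se ek] := topS oe.
  rewrite /partner !Htop ek -/ka -/o opp_classK opp_class_neq oe eqxx.
  by rewrite -/b eqxx.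
clearbody o b; split; last first.
  apply: (@leq_trans #|a |: ([set e | Some e == b] :|: [set e | Some e == o])|).
    apply/subset_leq_card/subsetP => e; rewrite !inE.
    by apply: contraR; rewrite !negb_or => /and3P[*]; rewrite Hp.
  have card1 (x : option E) : #|[set e | Some e == x]| <= 1.
    case: x => [x|]; last by rewrite eq_card0 // => e; rewrite inE.
    by rewrite -(cards1 x) subset_leq_card //; apply/subsetP=> e; rewrite !inE.
  rewrite cardsU1 (@leq_add _ _ 1 2) ?leq_b1 //.
  by rewrite (leq_trans (leq_card_setU _ _)) ?(@leq_add _ _ 1 1).
(* If [b] and [o] both exist, [a] takes over [o] and [b] becomes left over; if only [o] exists, it
   was left over and is now matched; without [o], [a] itself is left over. *)
pose a' := if o is Some o0 then if b is Some b0 then b0 else o0 else a.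
exists a' => e; rewrite !inE => nea'.
case: (eqVneq e a) nea' => [->|nea] nea'.
  rewrite pa (negbTE nSa) /=; move: nea'; rewrite /a'.
  by case: (o) => //; rewrite eqxx.
case: (eqVneq (Some e) o) nea' => [oe|neo] nea' /=.
  have [-> ->] := po e (esym oe); rewrite andbF.
  by move: nea'; rewrite /a' -oe; case: (b) => [?|]; rewrite ?eqxx ?andbF.
case: (eqVneq (Some e) b) nea' => [be|neb] nea' /=; last by rewrite Hp.
have [-> ->] := pb e (esym be); move: nea'.
by rewrite /a' -be; case: (o) => [?|//]; rewrite eqxx.
Qed.

(** Being symmetric in the two sets, this covers insertion and removal of [a] at once. *)
Definition agree_off a S S' := {in [set~ a], S =i S'}.

Lemma agree_offP a S S' : agree_off a S S' ->
  [\/ S = S', a \notin S /\ S' = a |: S | a \notin S' /\ S = a |: S'].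
Proof.
move=> agree; have eqSS' e : e != a -> (e \in S) = (e \in S').
  by move=> nea; apply: agree; rewrite !inE.
case: (boolP (a \in S)) (boolP (a \in S')) => [Sa | nSa] [S'a | nS'a].
- constructor 1; apply/setP=> e.
  by case: (eqVneq e a) => [->|/eqSS'//]; rewrite Sa S'a.
- constructor 3; split=> //; apply/setP=> e; rewrite !inE.
  by case: eqVneq => [->|/eqSS'//].
- constructor 2; split=> //; apply/setP=> e; rewrite !inE.
  by case: eqVneq => [->|/eqSS'//].
- constructor 1; apply/setP=> e.
  by case: (eqVneq e a) => [->|/eqSS'//]; rewrite (negbTE nSa) (negbTE nS'a).
Qed.

Lemma round_lipschitz c a S S' : agree_off a S S' ->
  (exists a', agree_off a' (leftover c S) (leftover c S')) /\
  #|[set e | partner c S e != partner c S' e]| <= 3.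
Proof.
case/agree_offP=> [-> | [nSa ->] | [nS'a ->]].
- by split; [exists a | rewrite eq_card0 // => e; rewrite inE eqxx].
- have [[a' Ha'] le3] := round_setU1 c nSa; split.
    by exists a' => e ea'; rewrite Ha'.
  apply: leq_trans le3; apply/subset_leq_card/subsetP=> e.
  by rewrite !inE eq_sym.
- exact: round_setU1.
Qed.

(** * Sequences of rounds *)

Fixpoint assign (cs : seq (E -> nat)) S e : option E :=
  if cs is c :: cs' then
    if partner c S e is Some e' then Some e' else assign cs' (leftover c S) e
  else None.

Definition leftovers cs S := foldl (fun S c => leftover c S) S cs.

(** Each round changes at most 3 partners and hands the next round two sets that again differ in at
    most one element, so the changes add up instead of multiplying. *)
Lemma assign_lipschitz cs a S S' : agree_off a S S' ->
  #|[set e | assign cs S e != assign cs S' e]| <= 3 * size cs.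
Proof.
elim: cs a S S' => [|c cs IH] a S S' agree /=.
  by rewrite eq_card0 // => e; rewrite inE.
have [[a' agree'] le3] := round_lipschitz c agree.
rewrite mulnS; apply: leq_trans (leq_add le3 (IH _ _ _ agree')).
apply: leq_trans (leq_card_setU _ _).
apply/subset_leq_card/subsetP=> e; rewrite !inE; apply: contraR.
by rewrite negb_or !negbK => /andP[/eqP-> /eqP->].
Qed.

Lemma assignP cs S e e' : assign cs S e = Some e' ->
  [/\ e \in S, e' \in S, side e' = ~~ side e & assign cs S e' = Some e].
Proof.
elim: cs S => //= c cs IH S.
case Ep: (partner c S e) => [e1|].
  by case=> <-; have [-> -> -> ->] := partnerP Ep.
case/IH; rewrite !inE => /andP[-> _] /andP[-> /eqP->] -> ->.
by split.
Qed.

Lemma assign_neq_None cs S e :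
  e \in S -> e \notin leftovers cs S -> assign cs S e.
Proof.
elim: cs S => /= [S -> //|c cs IH S Se nl].
by case Ep: partner => [//|]; apply: IH => //; rewrite inE Se Ep.
Qed.

Lemma leftover_subset c S : leftover c S \subset S.
Proof. by apply/subsetP=> e; rewrite inE => /andP[]. Qed.

Lemma leftovers_subset cs S : leftovers cs S \subset S.
Proof.
elim: cs S => //= c cs IH S; exact: subset_trans (IH _) (leftover_subset _ _).
Qed.

Lemma leftovers_cat cs1 cs2 S :
  leftovers (cs1 ++ cs2) S = leftovers cs2 (leftovers cs1 S).
Proof. exact: foldl_cat. Qed.

(** * Balance of the two sides and clearing of all elements *)

Definition part b S := [set e in S | side e == b].

(** The partner map injects the matched elements of each side into those of the other, so both sides
    lose equally many. *)
Lemma leftover_balanced c S :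
  #|part true S| = #|part false S| ->
  #|part true (leftover c S)| = #|part false (leftover c S)|.
Proof.
pose M b := [set e in part b S | partner c S e].
have leM b : #|M b| <= #|M (~~ b)|.
  pose f e := odflt e (partner c S e).
  have f_inj : {in M b &, injective f}.
    move=> e1 e2; rewrite !inE /f => /andP[_]; case E1: partner => [x|] // _.
    move=> /andP[_]; case E2: partner => [y|] //= _ xy; move: E1 E2.
    rewrite xy => /partnerP[_ _ _ E1] /partnerP[_ _ _]; rewrite E1.
    by case.
  rewrite -(card_in_imset f_inj); apply/subset_leq_card/subsetP.
  move=> _ /imsetP[e + ->]; rewrite !inE /f => /andP[/andP[_ /eqP eb]].
  case Ee: partner => [x|] //= _; have [_ -> -> ->] := partnerP Ee.
  by rewrite eb eqxx.
have eqM : #|M true| = #|M false|.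
  by apply/eqP; rewrite eqn_leq (leM true) (leM false).
have split_part b : #|part b S| = #|M b| + #|part b (leftover c S)|.
  rewrite -(cardsID [set e | partner c S e]); congr (_ + _).
    by apply: eq_card => e; rewrite !inE.
  apply: eq_card => e; rewrite !inE.
  by case: (e \in S) (partner c S e) (side e == b) => [] [?|] [].
by rewrite !split_part eqM => /addnI.
Qed.

Lemma leftovers_balanced cs S :
  #|part true S| = #|part false S| ->
  #|part true (leftovers cs S)| = #|part false (leftovers cs S)|.
Proof. by elim: cs S => //= c cs IH S /(leftover_balanced c)/IH. Qed.

Definition hash r (c : {ffun E -> 'I_r}) e : nat := c e.

(** In each bin met by both [A] and [D], the smallest element of side [true] gets matched, and
    distinct bins yield distinct elements. *)
Lemma leq_card_leftover r (c : {ffun E -> 'I_r}) (S A D : {set E}) :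
  A \subset part true S -> D \subset part false S ->
  #|part true (leftover (hash c) S)| + #|c @: A :&: c @: D| <= #|part true S|.
Proof.
move=> /subsetP subA /subsetP subD.
pose M := [set e in part true S | partner (hash c) S e].
have leM : #|c @: A :&: c @: D| <= #|M|.
  pose g (i : 'I_r) : option E := top (hash c) S (true, val i).
  have gP i : i \in c @: A :&: c @: D ->
      exists2 e, g i = Some e & e \in M /\ c e = i.
    case/setIP=> /imsetP[v /subA]; rewrite inE => /andP[Sv /eqP vt] iv.
    case/imsetP=> x /subD; rewrite inE => /andP[Sx /eqP xf] ix.
    rewrite /g; case E1: top => [e|]; last first.
      by case: topP E1 => // /(_ v Sv); case; rewrite /class /hash vt -iv.
    have [Se [et ei]] := topS E1; exists e => //; split; last exact: val_inj.
    rewrite !inE Se et eqxx /partner /class et ei E1 eqxx /opp_class /=.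
    by case: topP => // /(_ x Sx); rewrite /class /hash xf -ix.
  have [->|[i0 /gP[e0 _ _]]] := set_0Vmem (c @: A :&: c @: D).
    by rewrite cards0.
  pose h i := odflt e0 (g i).
  have h_inj : {in c @: A :&: c @: D &, injective h}.
    move=> i j /gP[e ge [_ ei]] /gP[e' ge' [_ ej]]; rewrite /h ge ge' /=.
    by move=> ee'; rewrite -ei -ej ee'.
  rewrite -(card_in_imset h_inj); apply/subset_leq_card/subsetP.
  by move=> _ /imsetP[i /gP[e ge [eM _]] ->]; rewrite /h ge.
rewrite addnC -(cardsID [set e | partner (hash c) S e] (part true S)).
rewrite leq_add //.
  by apply: leq_trans leM _; apply/subset_leq_card/subsetP=> e; rewrite !inE.
apply/subset_leq_card/subsetP=> e; rewrite !inE.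
by move=> /andP[/andP[-> /eqP->] ->].
Qed.

Lemma subset_of_card r (A : {set E}) :
  r <= #|A| -> exists2 B : {set E}, B \subset A & #|B| = r.
Proof.
move=> ler; exists [set e in take r (enum A)].
  by apply/subsetP=> e; rewrite inE => /mem_take; rewrite mem_enum.
rewrite cardsE (card_uniqP _) ?take_uniq ?enum_uniq // size_take -cardE.
by case: ltngtP ler.
Qed.

(** If [r] elements of each side survived, sets [A] and [D] of size exactly [r] could be chosen
    among the survivors. They are present in every round, in particular in the one whose hash is
    good for them. *)
Lemma phase_exists r L :
  0 < r -> #|E| ^ 2 * 48 ^ L < 49 ^ L ->
  exists2 cs : seq (E -> nat), size cs = L & forall S,
    #|part true S| = #|part false S| -> 7 * #|part true S| <= 8 * r ->
    #|part true (leftovers cs S)| < r.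
Proof.
move=> r_gt0 ltL; have [f fP] := hash_family_exists r_gt0 ltL.
exists [seq hash (f i) | i <- enum 'I_L].
  by rewrite size_map size_enum_ord.
move=> S balS leS; rewrite ltnNge; apply/negP=> ger.
have [A subA cardA] := subset_of_card ger.
rewrite (leftovers_balanced _ balS) in ger.
have [D subD cardD] := subset_of_card ger.
have disjAD : [disjoint A & D].
  apply/pred0P=> e /=; apply/negP=> /andP[/(subsetP subA) + /(subsetP subD)].
  by rewrite !inE => /andP[_ /eqP->] /andP[_].
have [i ltr] := fP _ _ cardA cardD disjAD.
have [cs1 [cs2 Ecs]] : exists cs1 cs2,
    [seq hash (f i) | i <- enum 'I_L] = cs1 ++ hash (f i) :: cs2.
  have: i \in enum 'I_L by rewrite mem_enum.
  by case/splitPr=> p1 p2; rewrite map_cat /=; do 2!eexists.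
have part_mono b (S1 S2 : {set E}) :
    S1 \subset S2 -> part b S1 \subset part b S2.
  by move=> /subsetP sub12; apply/subsetP=> e; rewrite !inE => /andP[/sub12->].
move: subA subD; rewrite Ecs leftovers_cat /=; set S1 := leftovers cs1 S.
have sub2 := leftovers_subset cs2 (leftover (hash (f i)) S1).
have sub1 := subset_trans sub2 (leftover_subset _ _).
move=> subA subD.
have := leq_card_leftover (f i) (subset_trans subA (part_mono _ _ _ sub1))
  (subset_trans subD (part_mono _ _ _ sub1)).
have := subset_leq_card (part_mono true _ _ (leftovers_subset cs1 S)).
have := subset_leq_card (subset_trans subA (part_mono true _ _ sub2)).
(* Round [i] starts with at most 8r/7 elements of side [true] and matches more than r/7 of them, so
   fewer than [r] remain, although [A] survives. *)
by rewrite cardA -/S1; lia.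
Qed.

Lemma clearing_exists p L n :
  #|E| ^ 2 * 48 ^ L < 49 ^ L -> 7 ^ p * n < 8 ^ p ->
  exists2 cs : seq (E -> nat), size cs <= p * L & forall S,
    #|part true S| = #|part false S| -> #|part true S| <= n ->
    leftovers cs S = set0.
Proof.
move=> ltL; elim: p n => [|p IHp] n lt_pow.
  exists [::] => // S balS leS /=; have n0 : n = 0 by lia.
  apply/setP=> e; rewrite inE; apply/negP=> Se.
  have c0 b : #|part b S| = 0 by case: b; lia.
  have /eqP := c0 (side e); rewrite cards_eq0 => /eqP/setP/(_ e).
  by rewrite !inE Se eqxx.
(* This is 7n/8 rounded up: large enough for a phase to apply to [n], while the at most [r.-1]
   elements left on each side number fewer than 7n/8 if [n] is positive. *)
pose r := (7 * n + 7) %/ 8.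
have [r0 | r_gt0] := posnP r.
  have n0 : n = 0 by lia.
  have [|cs szcs csP] := IHp 0; first by rewrite muln0 expn_gt0.
  exists cs; first by rewrite (leq_trans szcs) // leq_mul2r leqnSn orbT.
  by rewrite n0.
have [cs1 sz1 cs1P] := phase_exists r_gt0 ltL.
have [|cs2 sz2 cs2P] := IHp r.-1.
  have : 8 * r.-1 < 7 * n \/ r.-1 = 0 by lia.
  case=> [ltr|->]; last by rewrite muln0 expn_gt0.
  rewrite -(ltn_pmul2l (_ : 0 < 8)) // -expnS; apply: leq_ltn_trans lt_pow.
  by rewrite mulnCA expnS (mulnC 7) -mulnA leq_mul2l (ltnW ltr) orbT.
exists (cs1 ++ cs2); first by rewrite size_cat sz1 mulSn leq_add2l.
move=> S balS leS; rewrite leftovers_cat; apply: cs2P.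
  exact: leftovers_balanced.
have := cs1P S balS; lia.
Qed.

End Rounds.

(** * Workers and tasks *)

Section Assignment.
Variables w t : nat.
Local Notation element := ('I_w + 'I_t * 'I_w)%type.

Definition is_worker (e : element) : bool := if e is inl _ then true else false.

(* inr (j, k) is the k-th copy of task j. *)
Definition state (m : 'I_t -> nat) : {set element} :=
  [set e : element | if e is inr p then p.2 < m p.1 else true].

Lemma card_ord_lt n : n <= w -> #|[set k : 'I_w | k < n]| = n.
Proof.
move=> len.
by rewrite cardsE -sum1_card (big_ord_narrow len) sum1_card card_ord.
Qed.

Lemma card_state_workers m : #|part is_worker true (state m)| = w.
Proof.
rewrite -[RHS]card_ord -(card_imset _ (@inl_inj 'I_w ('I_t * 'I_w))).
apply: eq_card => -[v|[j k]]; rewrite !inE /= ?andbF; apply/esym.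
  by apply: imset_f.
by apply/imsetP=> -[].
Qed.

Lemma card_state_tasks m : (forall j, m j <= w) ->
  #|part is_worker false (state m)| = \sum_j m j.
Proof.
move=> lem; transitivity #|[set p : 'I_t * 'I_w | p.2 < m p.1]|.
  rewrite -(card_imset _ (@inr_inj 'I_w ('I_t * 'I_w))).
  apply: eq_card => -[v|[j k]]; rewrite !inE /= ?andbF; apply/esym.
    by apply/imsetP=> -[].
  by rewrite mem_imset ?inE ?andbT //; apply: inr_inj.
rewrite cardsE -sum1_card (eq_bigr (fun j => \sum_(k < w | k < m j) 1)).
  by rewrite pair_big_dep; apply: eq_bigl.
by move=> j _; rewrite sum1_card -[LHS](card_ord_lt (lem j)) cardsE.
Qed.

Lemma agree_off_state a (m m' : 'I_t -> nat) :
  (forall j, m j <= w) -> (forall j, m j = m' j + (a == j)) ->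
  exists e, agree_off e (state m) (state m').
Proof.
move=> lem mE; have lta : m' a < w by have := lem a; rewrite mE eqxx addn1.
(* Copies are numbered from 0, so the additional copy of [a] has number [m' a]. *)
exists (inr (a, Ordinal lta)) => -[v|[j k]]; rewrite !inE //= mE.
case: (eqVneq a j) => [<-|_]; rewrite ?addn0 // addn1 ltnS leq_eqVlt => nek.
by case: eqP => // kE; case/eqP: nek; congr (inr (_, _)); apply: val_inj.
Qed.

Lemma sum_tasks (T : task_multiset w t) : \sum_j tasks T j = w.
Proof.
rewrite -[RHS](eqP (valP T)) /= -sum1_size.
rewrite (eq_bigr (fun j => \sum_(i <- tasks T | i == j) 1)); last first.
  by move=> j _; rewrite sum1_count count_mem_mset.
rewrite (exchange_big_dep xpredT) //=; apply: eq_bigr => i _.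
by rewrite (big_pred1 i) // => j; rewrite /= eq_sym.
Qed.

Lemma leq_tasks (T : task_multiset w t) j : tasks T j <= w.
Proof. by rewrite -[leqRHS](sum_tasks T) (bigD1 j) //= leq_addr. Qed.

Lemma adjacentP (T1 T2 : task_multiset w t) : adjacent T1 T2 ->
  exists (m : 'I_t -> nat) a b, forall j,
    tasks T1 j = m j + (a == j) /\ tasks T2 j = m j + (b == j).
Proof.
have diff1 (T T' : task_multiset w t) :
    size (tasks T `\` tasks T')%mset == 1 ->
    exists a, forall j, tasks T j - tasks T' j = (a == j).
  case Es: (enum_mset (tasks T `\` tasks T')%mset) => [|a [|]] // _.
  by exists a => j; rewrite -msetE2 -count_mem_mset Es /= addn0.
case/andP=> /diff1[a Ha] /diff1[b Hb].
exists (fun j => minn (tasks T1 j) (tasks T2 j)), a, b => j.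
by rewrite -Ha -Hb; lia.
Qed.

Variables (j0 : 'I_t) (cs : seq (element -> nat)).

(** The default [j0] is reached only by workers left unmatched, of which there are none once the
    rounds clear the state. *)
Definition assignment (T : task_multiset w t) (v : 'I_w) : 'I_t :=
  if assign is_worker cs (state (tasks T)) (inl v) is Some (inr (j, _)) then j
  else j0.

(** The matching is injective on the cleared state. It maps the workers assigned to [j] into the
    copies of [j] and these copies back into those workers, so the two sets have equal size. *)
Lemma assignment_correct :
  (forall S : {set element},
     #|part is_worker true S| = #|part is_worker false S| ->
     #|part is_worker true S| <= w -> leftovers is_worker cs S = set0) ->
  is_assignment_function assignment.
Proof.
move=> clear T j; pose S := state (tasks T).
have l0 : leftovers is_worker cs S = set0.
  apply: clear; rewrite card_state_workers // card_state_tasks ?sum_tasks //.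
  exact: leq_tasks.
pose f e := odflt e (assign is_worker cs S e).
have fP e : e \in S -> assign is_worker cs S e = Some (f e).
  move=> Se; have := @assign_neq_None _ is_worker cs S e Se.
  by rewrite l0 inE /f => /(_ isT); case: assign.
have f_inj : {in S &, injective f}.
  move=> e1 e2 /fP/assignP[_ _ _ f1] /fP/assignP[_ _ _ f2] f12.
  by move: f1; rewrite f12 f2 => -[].
pose A := [set (inl v : element) | v in [set v | assignment T v == j]].
pose K := [set (inr (j, k) : element) | k in [set k : 'I_w | k < tasks T j]].
have subA : A \subset S by apply/subsetP=> _ /imsetP[v _ ->]; rewrite inE.
have subK : K \subset S.
  by apply/subsetP=> _ /imsetP[k + ->]; rewrite !inE.
have fA : f @: A \subset K.
  apply/subsetP=> _ /imsetP[_ /imsetP[v + ->] ->]; rewrite inE /assignment.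
  have Sv : inl v \in S by rewrite inE.
  rewrite (fP _ Sv); have [_ + + _] := assignP (fP _ Sv).
  case: (f _) => [//|[j' k]]; rewrite inE => ltk _ /eqP jj'.
  by apply/imsetP; exists k; rewrite ?inE -jj'.
have fK : f @: K \subset A.
  apply/subsetP=> _ /imsetP[e Ke ->].
  have Se := subsetP subK _ Ke; have := assignP (fP _ Se).
  case/imsetP: Ke => k _ ->; case: (f _) => [v [_ _ _ fv]|p []//].
  by apply: imset_f; rewrite inE /assignment fv.
have cardA : #|A| = #|[set v | assignment T v == j]|.
  by rewrite card_imset //; apply: inl_inj.
have cardK : #|K| = tasks T j.
  by rewrite card_imset ?card_ord_lt ?leq_tasks // => k k' [].
rewrite -cardA -cardK; apply/eqP; rewrite eqn_leq; apply/andP; split.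
  by rewrite -(card_in_imset (sub_in2 (subsetP subA) f_inj)) subset_leq_card.
by rewrite -(card_in_imset (sub_in2 (subsetP subK) f_inj)) subset_leq_card.
Qed.

(** The common part of two adjacent inputs is one element away from each, so the bound of 3 per
    round is paid twice. *)
Lemma switching_cost_assignment :
  switching_cost assignment <= 6 * size cs.
Proof.
apply/bigmax_leqP=> -[T1 T2] /adjacentP[m [a [b /= mE]]].
have [e1 agree1] := agree_off_state (leq_tasks T1) (fun j => (mE j).1).
have [e2 agree2] := agree_off_state (leq_tasks T2) (fun j => (mE j).2).
have := leq_add (assign_lipschitz is_worker cs agree1)
  (assign_lipschitz is_worker cs agree2).
rewrite -mulnDl; apply: leq_trans; apply: leq_trans (leq_card_setU _ _).
rewrite /pair_switching_cost -(card_imset _ (@inl_inj 'I_w ('I_t * 'I_w))).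
apply/subset_leq_card/subsetP=> _ /imsetP[v + ->]; rewrite !inE /assignment.
by apply: contraR; rewrite negb_or !negbK => /andP[/eqP-> /eqP->].
Qed.

End Assignment.

(** * Choice of the constants and the logarithmic bound *)

(** Bernoulli's inequality gives (1 + 1/b)^b >= 2, which is then raised to the power [q]. *)
Lemma geometric_ratio b p q : 0 < b -> p = b * q -> 2 ^ q * b ^ p <= b.+1 ^ p.
Proof.
move=> b_gt0 ->; rewrite !expnM -expnMn; apply: leq_wexp2r.
have bernoulli n : b ^ n * (b + n) <= b * b.+1 ^ n.
  elim: n => [|n IHn]; first by rewrite addn0 mul1n muln1.
  have := leq_mul (leqnn b.+1) IHn; rewrite !expnS.
  by move: (b ^ n) (b.+1 ^ n) => x y; nia.
have := bernoulli b; rewrite addnn -muln2 mulnA -(leq_pmul2l b_gt0).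
by nia.
Qed.

Lemma assignment_exists :
  exists K : nat, forall w t, 2 <= w -> 2 <= t ->
    exists2 phi : task_multiset w t -> 'I_w -> 'I_t,
      is_assignment_function phi &
      switching_cost phi <= K * (trunc_log 2 w * trunc_log 2 (w * t)).
Proof.
exists (6 * (14 * 384)) => w t w_ge2 t_ge2.
set lw := trunc_log 2 w; set lwt := trunc_log 2 (w * t).
have lw_gt0 : 0 < lw by rewrite trunc_log_gt0.
have lwt_gt0 : 0 < lwt by rewrite trunc_log_gt0 /=; nia.
(* With 14 = 7 * 2, the ratio (8/7)^(14 lw) is at least 2^(2 lw) >= 2^(lw + 1) > w, since [lw] is
   positive. *)
have lt_phases : 7 ^ (14 * lw) * w < 8 ^ (14 * lw).
  apply: leq_trans (@geometric_ratio 7 (14 * lw) (2 * lw) isT _); last by lia.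
  rewrite mulnC ltn_pmul2r ?expn_gt0 //.
  apply: leq_trans (trunc_log_ltn w (isT : 1 < 2)) _.
  by rewrite leq_exp2l // -/lw; lia.
(* With 384 = 48 * 8, the ratio (49/48)^(384 lwt) is at least 2^(8 lwt) >= 2^(4 (lwt + 1)) > (wt)^4,
   and (wt)^4 >= |E|^2 because |E| = w + tw <= (wt)^2. *)
have lt_rounds :
    #|{: 'I_w + 'I_t * 'I_w}| ^ 2 * 48 ^ (384 * lwt) < 49 ^ (384 * lwt).
  apply: leq_trans (@geometric_ratio 48 (384 * lwt) (8 * lwt) isT _);
    last by lia.
  rewrite ltn_pmul2r ?expn_gt0 // card_sum card_prod !card_ord.
  apply: (@leq_ltn_trans ((w * t) ^ 4)).
    by rewrite (expnM _ 2 2) leq_sqr -mulnn; nia.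
  apply: (@leq_trans ((2 ^ lwt.+1) ^ 4)).
    by rewrite ltn_exp2r // trunc_log_ltn.
  by rewrite -expnM leq_exp2l //; lia.
have [cs le_cs csP] := clearing_exists (@is_worker w t) lt_rounds lt_phases.
have j0 : 'I_t by exists 0; apply: leq_trans t_ge2.
exists (assignment j0 cs); first exact: assignment_correct.
apply: leq_trans (switching_cost_assignment j0 cs) _.
by rewrite -mulnA (mulnACA 14 384) leq_mul2l.
Qed.

Local Open Scope ring_scope.

Lemma trunc_log2_le_ln (R : realType) n : (0 < n)%N ->
  (trunc_log 2 n)%:R * ln 2 <= ln (n%:R : R).
Proof.
move=> n_gt0; rewrite mulr_natl -lnXn ?ltr0n //.
rewrite ler_ln ?posrE ?exprn_gt0 ?ltr0n //.
by rewrite -natrX ler_nat trunc_logP.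
Qed.

Unset Implicit Arguments.

Theorem theorem1 (R : realType) :
  exists C : R, 0 < C /\
    forall w t : nat, (2 <= w)%N -> (2 <= t)%N ->
      exists phi : task_multiset w t -> 'I_w -> 'I_t,
        is_assignment_function phi /\
        (switching_cost phi)%:R <= C * ln (w%:R : R) * ln ((w * t)%:R : R).
Proof.
have ln2_gt0 : 0 < ln (2 : R) by rewrite ln_gt0 // ltr1n.
have [K costK] := assignment_exists.
(* Each of the two binary logarithms costs a factor 1 / ln 2; the successor of [K] makes the
   constant positive. *)
exists (K.+1%:R / ln 2 ^+ 2); split.
  by rewrite divr_gt0 ?exprn_gt0 ?ltr0n.
move=> w t w_ge2 t_ge2.
have [phi phi_assign phi_cost] := costK w t w_ge2 t_ge2.
exists phi; split=> //.
have le_w := @trunc_log2_le_ln R w (ltnW w_ge2).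
have le_wt : (trunc_log 2 (w * t))%:R * ln 2 <= ln ((w * t)%:R : R).
  by apply: trunc_log2_le_ln; rewrite muln_gt0 (ltnW w_ge2) (ltnW t_ge2).
apply: (@le_trans _ _ (K.+1 * (trunc_log 2 w * trunc_log 2 (w * t)))%:R).
  by rewrite ler_nat (leq_trans phi_cost) // leq_mul2r leqnSn orbT.
rewrite -!mulrA natrM (natrM _ (trunc_log _ _)).
apply: ler_wpM2l => //; rewrite ler_pdivlMl ?exprn_gt0 // mulrC expr2 mulrACA.
by apply: ler_pM; rewrite ?mulr_ge0 ?(ltW ln2_gt0).
Qed.
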